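(* For every integer $n\geq 1$, the lattice kissing number of the $n$-dimensional cross-polytope $K_n$ satisfies $\kappa_L(K_n)<12(2^n-1)$.
   Context: Let $\|x\|_1=\sum_{i=1}^n|x_i|$ and $K_n=\{x\in\mathbb{R}^n:\|x\|_1\leq 1\}$ (the cross-polytope). A lattice in $\mathbb{R}^n$ is the $\mathbb{Z}$-span of a basis of $\mathbb{R}^n$. The lattice kissing number $\kappa_L(K_n)$ is the maximum, over all lattices $\Lambda\subset\mathbb{R}^n$ with $\min_{x\in\Lambda\setminus\{0\}}\|x\|_1=1$, of the cardinality of $\{x\in\Lambda:\|x\|_1=1\}$. *)

(* Defs.v *)
From HB Require Import structures.
From mathcomp Require Import all_boot all_order all_algebra.
From mathcomp Require Import all_classical all_reals.

Set Implicit Arguments.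
Unset Strict Implicit.
Unset Printing Implicit Defensive.

Import Order.TTheory GRing.Theory Num.Theory.

Local Open Scope classical_set_scope.
Local Open Scope card_scope.
Local Open Scope ring_scope.

Definition l1norm (R : realType) (n : nat) (x : 'rV[R]_n) : R :=
  \sum_(i < n) `|x 0 i|.

Definition is_lattice (R : realType) (n : nat) (L : set 'rV[R]_n) : Prop :=
  exists2 b : n.-tuple 'rV[R]_n, basis_of fullv b &
    L = [set x | exists z : 'I_n -> int, x = \sum_(i < n) tnth b i *~ z i].

Definition l1_minimum (R : realType) (n : nat) (L : set 'rV[R]_n) (m : R)
    : Prop :=
  (exists x, [/\ L x, x != 0 & l1norm x = m]) /\
  (forall x, L x -> x != 0 -> m <= l1norm x).

Definition l1_unit_vectors (R : realType) (n : nat) (L : set 'rV[R]_n)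
    : set 'rV[R]_n :=
  [set x | L x /\ l1norm x = 1].

(* [k] is the maximum of the cardinalities of [l1_unit_vectors L] over the
   lattices [L] of l1-minimum 1. The second clause also excludes infinite
   cardinalities, so at most one [k] satisfies the predicate. *)
Definition is_cross_polytope_lattice_kissing_number
    (R : realType) (n k : nat) : Prop :=
  (exists L : set 'rV[R]_n,
     [/\ is_lattice L, l1_minimum L 1 & l1_unit_vectors L #= `I_k]) /\
  (forall L : set 'rV[R]_n,
     is_lattice L -> l1_minimum L 1 -> l1_unit_vectors L #<= `I_k).

(* Main.v *)
Require Import Defs.
From mathcomp Require Import all_boot all_order all_algebra.
From mathcomp Require Import all_classical all_reals.
From mathcomp Require Import zify lra.

(** Let [L] be a lattice of l1-minimum 1 and [U] its set of vectors of norm 1.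
    No vector of [U] lies in [2L], since half of it would be a shorter lattice
    vector. If [x], [y] in [U] are congruent modulo [2L] and [x] is not [y] or
    [- y], then [(x + y)/2] and [(x - y)/2] are nonzero lattice vectors, so
    [x + y] and [x - y] both have norm at least [2 = |x| + |y|]. The triangle
    inequality is then an equality in every coordinate for both signs, which
    forces [x] and [y] to have disjoint supports ([same_class_disjoint]).
    Hence a vector of [U] is determined up to sign by its class in [L/2L] and
    its support, and [#|U| <= 2 * #|P|] where [P] is the set of the pairs
    (class, support) that occur.

    It remains to see that [#|P| < 6(2^n - 1)] ([labelled_sets_count]). Within
    one class the supports are disjoint, so at most 5 of them have more than
    [n/6] elements; with [2^n - 1] nonzero classes this gives [5(2^n - 1)]
    pairs. A nonempty support [S] with at most [n/6] elements occurs in at most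
    [2^|S|] classes: lattice vectors whose classes are independent over [F_2]
    are independent over [R], since an odd determinant is not zero, and
    the vectors supported in [S] span dimension at most [|S|]
    ([card_classes_supp_le]). The sum of [2^|S|] over all sets with
    [6|S| <= n], the empty set included, is less than [2^n] by an
    exponential-moment estimate ([small_set_sum_lt]); the empty set is not
    a support, so removing its term 1 leaves fewer than [2^n - 1] pairs.

    The bound makes every [U] finite, and the lattice [Z^n] shows that the set
    of attained cardinalities is not empty, so their maximum exists. *)

Set Implicit Arguments.
Unset Strict Implicit.
Unset Printing Implicit Defensive.

Import Order.TTheory GRing.Theory Num.Theory.

Local Open Scope ring_scope.
Local Open Scope card_scope.

(** * Counting disjoint labelled sets *)

(** Weighting each [S] by [w ^ (n - 6 * #|S|)] with [w = 3/2] does not decrease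
    the terms of the sum, and over all [S] the weighted terms add up to
    [(w + 2 / w ^ 5) ^ n], where [w + 2 / w ^ 5 = 857 / 486 < 2]. The proof
    clears the denominator [486 = 2 * 3 ^ 5]. *)
Lemma small_set_sum_lt (n : nat) : (0 < n)%N ->
  (\sum_(S : {set 'I_n} | (6 * #|S| <= n)%N) 2 ^ #|S| < 2 ^ n)%N.
Proof.
move=> n_gt0.
have binomial_expansion :
    (\sum_(S : {set 'I_n}) 128 ^ #|S| * 729 ^ (n - #|S|) = 857 ^ n)%N.
  have := @bigA_distr nat 0%N 1%N muln addn 'I_n (fun=> 128%N) (fun=> 729%N).
  rewrite big_const_ord iter_muln_1 => ->; apply: eq_bigr => S _.
  rewrite (bigID (mem S)) /=; congr (_ * _)%N.
    by rewrite -prod_nat_const; apply: eq_bigr => i ->.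
  have -> : (n - #|S| = #|finset.setC S|)%N.
    by rewrite (cardsCs (finset.setC S)) finset.setCK card_ord.
  rewrite -prod_nat_const.
  by apply: eq_big => [i|i]; rewrite finset.in_setC // => /negPf ->.
rewrite -(@ltn_pmul2r (486 ^ n)) ?expn_gt0 // -expnMn.
apply: (@leq_ltn_trans (857 ^ n)); last by rewrite ltn_exp2r.
rewrite -binomial_expansion big_distrl /= big_mkcond; apply: leq_sum => S _.
case: ifP => // small.
have le_Sn : (#|S| <= n)%N by rewrite -[leqRHS]card_ord max_card.
move: small le_Sn; move: #|S| => s small le_sn.
have [d ->] : exists d, n = (6 * s + d)%N by exists (n - 6 * s)%N; lia.
have -> : (6 * s + d - s = 5 * s + d)%N by lia.
rewrite -[486%N]/(2 * 3 ^ 5)%N -[128%N]/(2 ^ 7)%N -[729%N]/(3 ^ 6)%N.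
rewrite (expnMn 2 (3 ^ 5)) -!expnM mulnA -expnD.
have -> : (s + (6 * s + d) = 7 * s + d)%N by lia.
have -> : (5 * (6 * s + d) = 30 * s + 5 * d)%N by lia.
have -> : (6 * (5 * s + d) = 30 * s + 5 * d + d)%N by lia.
rewrite (expnD 2) (expnD 3 _ d) -mulnA leq_mul2l (mulnC (2 ^ d)%N) leq_mul2l.
do 2!(apply/orP; right).
by case: (d) => [//|d']; rewrite leq_exp2r.
Qed.

Lemma card_disjoint_large_le5 (T : finType) (F : {set {set T}}) :
  {in F &, forall A B : {set T}, A != B -> [disjoint A & B]} ->
  {in F, forall A : {set T}, (#|T| < 6 * #|A|)%N} ->
  (#|F| <= 5)%N.
Proof.
move=> /finset.trivIsetP/eqP card_cover large.
have sum_le : (\sum_(A in F) #|A| <= #|T|)%N.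
  by rewrite card_cover max_card.
have : (#|F| * #|T|.+1 <= 6 * \sum_(A in F) #|A|)%N.
  rewrite -sum_nat_const big_distrr /=; exact: leq_sum.
nia.
Qed.

(** With [C] the set of classes modulo [2L], [c0] the zero class and [P] the set
    of the pairs (class, support) of the minimal vectors, this is the whole
    combinatorial part of the theorem. A set counts as
    large when it has more than [n / 6] elements: a label carries at most 5 large
    sets, and the small sets account for fewer than [2 ^ n - 1] pairs. *)
Lemma labelled_sets_count (n : nat) (C : finType) (P : {set C * {set 'I_n}})
    (c0 : C) :
  (0 < n)%N -> #|C| = (2 ^ n)%N ->
  (forall c S, (c, S) \in P -> c != c0) ->
  (forall c S, (c, S) \in P -> S != finset.set0) ->
  (forall c S S', (c, S) \in P -> (c, S') \in P -> S != S' ->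
     [disjoint S & S']) ->
  (forall S, (#|[set c | (c, S) \in P]%SET| <= 2 ^ #|S|)%N) ->
  (#|P| < 6 * (2 ^ n - 1))%N.
Proof.
move=> n_gt0 cardC c_neq0 S_neq0 disj few.
pose large (p : C * {set 'I_n}) := (n < 6 * #|p.2|)%N.
have large_le : (#|[set p in P | large p]%SET| <= 5 * (2 ^ n - 1))%N.
  rewrite -sum1_card (partition_big (fun p => p.1) (predC1 c0)) /=; last first.
    by case=> c S; rewrite finset.inE => /andP[/c_neq0].
  have <- : (\sum_(c | c != c0) 5 = 5 * (2 ^ n - 1))%N.
    by rewrite sum_nat_const cardC1 cardC subn1 mulnC.
  apply: leq_sum => c _; rewrite sum1_card.
  pose F := [set S | (c, S) \in P & large (c, S)]%SET.
  have <- : #|F| = #|[pred p in [set p in P | large p]%SET | p.1 == c]|.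
    rewrite -(@card_imset _ _ (fun S => (c, S)) (mem F)); last by move=> ? ? [].
    apply: eq_card => -[c' S]; rewrite [RHS]inE /= finset.inE.
    apply/imsetP/idP => [[S'] | /andP[PcS /eqP ec]].
      by rewrite finset.inE => ? [-> ->]; rewrite eqxx andbT.
    by exists S; rewrite ?finset.inE -ec.
  apply: card_disjoint_large_le5.
    move=> A B; rewrite !finset.inE => /andP[PA _] /andP[PB _].
    exact: disj PA PB.
  by move=> A; rewrite finset.inE card_ord => /andP[].
have small_le : (#|[set p in P | ~~ large p]%SET| <
    \sum_(S : {set 'I_n} | 6 * #|S| <= n) 2 ^ #|S|)%N.
  (* The term of the empty set supplies the strict inequality. *)
  rewrite (bigD1 finset.set0) /= ?finset.cards0 ?muln0 // expn0 add1n ltnS.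
  rewrite -sum1_card (partition_big (fun p => p.2)
    (fun S : {set 'I_n} => (6 * #|S| <= n) && (S != finset.set0))%N) /=;
    last first.
    case=> c S; rewrite finset.inE /large /= -leqNgt => /andP[PcS ->].
    exact: S_neq0 PcS.
  apply: leq_sum => S _; rewrite sum1_card; apply: leq_trans (few S).
  rewrite -(@card_imset _ _ (fun c => (c, S)) (mem [set c | (c, S) \in P]%SET));
    last by move=> ? ? [].
  apply/subset_leq_card/fintype.subsetP => -[c S'].
  rewrite unfold_in /= finset.inE => /andP[/andP[PcS _] /eqP eS].
  by apply/imsetP; exists c; [rewrite finset.inE -eS | rewrite eS].
have -> : #|P| = (#|[set p in P | large p]%SET|
                 + #|[set p in P | ~~ large p]%SET|)%N.
  rewrite -(cardsID [set p | large p]%SET P).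
  by congr (_ + _)%N; apply: eq_card => p; rewrite !finset.inE // andbC.
have := small_set_sum_lt n_gt0; have : (0 < 2 ^ n)%N by rewrite expn_gt0.
lia.
Qed.

(** * Lattices and their classes modulo 2 *)

Definition lattice_of (R : realType) (n : nat) (B : 'M[R]_n) : set 'rV[R]_n :=
  [set x | exists z : 'rV[int]_n, x = map_mx intr z *m B]%classic.

Lemma is_lattice_of (R : realType) (n : nat) (L : set 'rV[R]_n) :
  is_lattice L -> exists2 B : 'M[R]_n, B \in unitmx & L = lattice_of B.
Proof.
case=> b b_basis ->; pose B := \matrix_i tnth b i; exists B.
  pose C : 'M[R]_n := \matrix_(i, j) coord b j (delta_mx 0 i).
  have /mulmx1_unit[] // : C *m B = 1%:M.
  apply/row_matrixP => i; rewrite row_mul row1.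
  have := coord_basis b_basis (memvf (delta_mx 0 i : 'rV[R]_n)).
  move=> ->; rewrite mulmx_sum_row; apply: eq_bigr => j _.
  by rewrite rowK !mxE (tnth_nth 0).
apply/seteqP; split=> x [z ->].
  exists (\row_i z i); rewrite mulmx_sum_row; apply: eq_bigr => i _.
  by rewrite rowK !mxE scaler_int.
exists (z 0); rewrite mulmx_sum_row; apply: eq_bigr => i _.
by rewrite rowK !mxE scaler_int.
Qed.

Lemma lattice_ofD (R : realType) n (B : 'M[R]_n) x y :
  lattice_of B x -> lattice_of B y -> lattice_of B (x + y).
Proof. by move=> [z ->] [w ->]; exists (z + w); rewrite map_mxD mulmxDl. Qed.

Lemma lattice_ofN (R : realType) n (B : 'M[R]_n) x :
  lattice_of B x -> lattice_of B (- x).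
Proof. by move=> [z ->]; exists (- z); rewrite map_mxN mulNmx. Qed.

(** The class of [x] in [L/2L], for [L] the lattice with basis the rows of [B]:
    the coordinates of [x] in this basis are integers when [x] is in [L], and
    then taking floors does not change them. *)
Definition coords_mod2 (R : realType) n (B : 'M[R]_n) (x : 'rV[R]_n) :
    'rV['F_2]_n :=
  map_mx (fun r => (Num.floor r)%:~R) (x *m invmx B).

Lemma coords_mod2E (R : realType) n (B : 'M[R]_n) (z : 'rV[int]_n) :
  B \in unitmx -> coords_mod2 B (map_mx intr z *m B) = map_mx intr z.
Proof.
move=> B_unit; rewrite /coords_mod2 mulmxK //.
by apply/rowP => i; rewrite !mxE intrKfloor.
Qed.

Lemma coords_mod2D (R : realType) n (B : 'M[R]_n) x y : B \in unitmx ->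
  lattice_of B x -> lattice_of B y ->
  coords_mod2 B (x + y) = coords_mod2 B x + coords_mod2 B y.
Proof.
by move=> Bu [z ->] [w ->]; rewrite -mulmxDl -!map_mxD !coords_mod2E // map_mxD.
Qed.

Lemma coords_mod2N (R : realType) n (B : 'M[R]_n) x : B \in unitmx ->
  lattice_of B x -> coords_mod2 B (- x) = coords_mod2 B x.
Proof.
move=> Bu [z ->]; rewrite -mulNmx -map_mxN !coords_mod2E // map_mxN.
by apply/rowP => i; rewrite !mxE (oppr_pchar2 (pchar_Fp (isT : prime 2))).
Qed.

Lemma coords_mod2_eq0 (R : realType) n (B : 'M[R]_n) x : B \in unitmx ->
  lattice_of B x -> coords_mod2 B x = 0 ->
  exists2 u, lattice_of B u & x = u *+ 2.
Proof.
move=> Bu [z ->]; rewrite coords_mod2E // => z_even.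
pose w := map_mx (fun k => (k %/ 2)%Z) z; exists (map_mx intr w *m B).
  by exists w.
rewrite mulr2n -mulmxDl -map_mxD; congr (map_mx _ _ *m _); apply/rowP => i.
have /rowP/(_ i)/eqP := z_even; rewrite !mxE.
rewrite -(dvdz_pcharf (pchar_Fp (isT : prime 2))); lia.
Qed.

(** * Minimal vectors in one class *)

Lemma l1normMn2 (R : realType) n (x : 'rV[R]_n) :
  l1norm (x *+ 2) = l1norm x *+ 2.
Proof.
by rewrite -sumrMnl; apply: eq_bigr => i _; rewrite mulr2n mxE -mulr2n normrMn.
Qed.

Definition supp (R : realType) n (x : 'rV[R]_n) : {set 'I_n} :=
  [set i | x 0 i != 0]%SET.

Lemma supp_eq0 (R : realType) n (x : 'rV[R]_n) :
  (supp x == finset.set0) = (x == 0).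
Proof.
apply/eqP/eqP => [x0|->]; last by apply/setP => i; rewrite !finset.inE mxE eqxx.
apply/rowP => i; move/setP/(_ i) : x0; rewrite !finset.inE mxE.
by move/negbFE/eqP.
Qed.

Lemma suppN (R : realType) n (x : 'rV[R]_n) : supp (- x) = supp x.
Proof. by apply/setP => i; rewrite !finset.inE mxE oppr_eq0. Qed.

(** Otherwise half of [x] would be a lattice vector of norm [1/2]. *)
Lemma coords_mod2_neq0 (R : realType) n (B : 'M[R]_n) x : B \in unitmx ->
  l1_minimum (lattice_of B) 1 -> l1_unit_vectors (lattice_of B) x ->
  coords_mod2 B x != 0.
Proof.
move=> Bu [_ min1] [Lx x1]; apply/eqP => /(coords_mod2_eq0 Bu Lx)[u Lu xu].
have u0 : u != 0.
  apply: contra_eqN x1 => /eqP u0; rewrite xu u0 mul0rn /l1norm big1 => [|i _].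
    by rewrite eq_sym oner_eq0.
  by rewrite mxE normr0.
have := min1 u Lu u0; move: x1; rewrite xu l1normMn2; lra.
Qed.

(** The half-sum and the half-difference of [x] and [y] are lattice vectors.
    When both are nonzero, [x + y] and [x - y] have norm at least [2], so that
    no coordinate leaves slack in [`|a + b| + `|a - b| <= 2 `|a| + 2 `|b|]; and
    this inequality is strict unless [a] or [b] is zero. *)
Lemma same_class_disjoint (R : realType) n (B : 'M[R]_n) x y : B \in unitmx ->
  l1_minimum (lattice_of B) 1 ->
  l1_unit_vectors (lattice_of B) x -> l1_unit_vectors (lattice_of B) y ->
  coords_mod2 B x = coords_mod2 B y ->
  [\/ x = y, x = - y | [disjoint supp x & supp y]].
Proof.
move=> Bu [_ min1] [Lx x1] [Ly y1] xy.
have LNy := lattice_ofN Ly.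
have norm_ge2 v : lattice_of B v -> coords_mod2 B v = 0 -> v != 0 ->
    2 <= l1norm v.
  move=> Lv /(coords_mod2_eq0 Bu Lv)[u Lu ->] u0.
  have u_neq0 : u != 0 by apply: contraNneq u0 => ->; rewrite mul0rn.
  have := min1 u Lu u_neq0; rewrite l1normMn2; lra.
have c0 (c : 'rV['F_2]_n) : c + c = 0.
  by apply/rowP => i; rewrite !mxE (addrr_pchar2 (pchar_Fp (isT : prime 2))).
have [->|xNy] := eqVneq x y; first by constructor 1.
have [->|xNNy] := eqVneq x (- y); first by constructor 2.
constructor 3.
have D2 : 2 <= l1norm (x + y).
  by apply: norm_ge2; rewrite ?coords_mod2D ?xy ?addr_eq0 //; exact: lattice_ofD.
have B2 : 2 <= l1norm (x - y).
  apply: norm_ge2; rewrite ?coords_mod2D ?coords_mod2N ?xy ?subr_eq0 //.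
  exact: lattice_ofD.
pose slack i :=
  `|x 0 i| *+ 2 + `|y 0 i| *+ 2 - `|x 0 i + y 0 i| - `|x 0 i - y 0 i|.
have slack_ge0 i : 0 <= slack i.
  have := ler_normD (x 0 i) (y 0 i); have := ler_normB (x 0 i) (y 0 i).
  rewrite /slack; lra.
have slack0 : \sum_i slack i <= 0.
  rewrite /slack !sumrB big_split /= !sumrMnl -/(l1norm x) -/(l1norm y) x1 y1.
  move: D2 B2; rewrite /l1norm.
  rewrite (eq_bigr (fun i => `|x 0 i + y 0 i|)); last by move=> i _; rewrite mxE.
  rewrite [X in _ -> 2 <= X -> _](eq_bigr (fun i => `|x 0 i - y 0 i|));
    last by move=> i _; rewrite !mxE.
  lra.
rewrite -setI_eq0; apply/eqP/setP => i; rewrite !finset.inE; apply/negbTE.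
rewrite negb_and !negbK.
have : slack i = 0.
  apply/eqP; rewrite eq_le slack_ge0 andbT; apply: le_trans slack0.
  by rewrite (bigD1 i) //= lerDl sumr_ge0.
rewrite /slack.
case: (ger0P (x 0 i)) => hx; case: (ger0P (y 0 i)) => hy;
case: (ger0P (x 0 i + y 0 i)) => hD; case: (ger0P (x 0 i - y 0 i)) => hB;
by move=> e; apply/orP; first [left; apply/eqP; lra | right; apply/eqP; lra].
Qed.

(** * Classes of the lattice vectors with a given support *)

(** A right inverse modulo 2, lifted to integers, makes a product whose
    determinant is odd, hence nonzero. *)
Lemma row_free_mod2 (R : numFieldType) (m n : nat) (Z : 'M[int]_(m, n)) :
  row_free (map_mx intr Z : 'M['F_2]_(m, n)) ->
  row_free (map_mx intr Z : 'M[R]_(m, n)).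
Proof.
case/row_freeP=> W ZW.
pose W' : 'M[int]_(n, m) := map_mx (fun a : 'F_2 => (a : nat)%:Z) W.
have W'E : map_mx intr W' = W.
  by apply/matrixP => i j; rewrite !mxE -[RHS]natr_Zp.
have det_odd : ((\det (Z *m W'))%:~R : 'F_2) = 1.
  by rewrite -det_map_mx map_mxM W'E ZW det1.
have det_neq0 : \det (Z *m W') != 0.
  by apply: contra_eq_neq det_odd => ->; rewrite eq_sym oner_eq0.
have : map_mx intr (Z *m W') \in @unitmx R m.
  by rewrite unitmxE unitfE det_map_mx intr_eq0.
rewrite map_mxM => ZW_unit; apply/row_freeP.
exists (map_mx intr W' *m invmx (map_mx intr Z *m map_mx intr W')).
by rewrite mulmxA mulmxV.
Qed.

Lemma rank_supp_le (F : fieldType) (m n : nat) (A : 'M[F]_(m, n))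
    (S : {set 'I_n}) :
  (forall i j, j \notin S -> A i j = 0) -> (\rank A <= #|S|)%N.
Proof.
move=> A0; suff -> : A = colsub (enum_val : 'I_#|S| -> 'I_n) A
                         *m rowsub enum_val 1%:M.
  exact: mulmx_max_rank.
apply/matrixP => i j; rewrite !mxE.
have [jS|jNS] := boolP (j \in S).
  rewrite (bigD1 (enum_rank_in jS j)) //= !mxE enum_rankK_in // eqxx mulr1.
  rewrite big1 ?addr0 // => k kj; rewrite !mxE.
  case: eqP => [e|]; last by rewrite mulr0.
  by move: kj; rewrite -(inj_eq enum_val_inj) enum_rankK_in // e eqxx.
rewrite A0 // big1 // => k _; rewrite !mxE.
case: eqP => [e|]; last by rewrite mulr0.
by move: jNS; rewrite -e enum_valP.
Qed.

(** The classes in [D] span a space over [F_2] of some dimension [r], so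
    [#|D| <= 2 ^ r]. Lattice vectors supported in [S] that lift a basis of this
    space chosen in [D] stay independent over [R], hence [r <= #|S|]. *)
Lemma card_classes_supp_le (R : realType) n (B : 'M[R]_n) (S : {set 'I_n})
    (D : {set 'rV['F_2]_n}) :
  B \in unitmx ->
  {in D, forall c, exists x,
     [/\ lattice_of B x, supp x \subset S & coords_mod2 B x = c]} ->
  (#|D| <= 2 ^ #|S|)%N.
Proof.
move=> Bu lift.
pose M : 'M['F_2]_(#|D|, n) := \matrix_i enum_val i.
have lift_row (i : 'I_#|D|) : {z : 'rV[int]_n | map_mx intr z = enum_val i &
    supp (map_mx intr z *m B) \subset S}.
  apply: cid2; have [x [[z ->] xS <-]] := lift _ (enum_valP i).
  by exists z; rewrite ?coords_mod2E.
pose f := maxrankfun M.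
pose Z : 'M[int]_(\rank M, n) := \matrix_i s2val (lift_row (f i)).
have Z_mod2 : map_mx intr Z = rowsub f M.
  apply/row_matrixP => i; rewrite -map_row rowK row_rowsub rowK.
  exact: s2valP (lift_row (f i)).
have /(@row_free_mod2 R) Z_free : row_free (map_mx intr Z : 'M['F_2]_(_, n)).
  by rewrite Z_mod2 maxrowsub_free.
(* [Z *m B] has as rows the lifts of a basis of the row space of [M]. *)
have rank_le : (\rank M <= #|S|)%N.
  rewrite -(eqP Z_free) -(mxrankMfree _ (_ : row_free B)) ?row_free_unit //.
  apply: rank_supp_le => i j jS.
  have rowZ : s2val (lift_row (f i)) = row i Z by rewrite rowK.
  have := s2valP' (lift_row (f i)); rewrite rowZ map_row -row_mul.
  move=> /fintype.subsetP/(_ j)/contraNN/(_ jS).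
  by rewrite finset.inE mxE negbK => /eqP.
have -> : #|D| = #|[set enum_val i | i : 'I_#|D|]%SET|.
  by rewrite card_imset ?card_ord //; exact: enum_val_inj.
apply: (@leq_trans #|[set d *m row_base M | d : 'rV['F_2]_(\rank M)]%SET|).
  apply/subset_leq_card/fintype.subsetP => _ /imsetP[i _ ->].
  have /submxP[d dE] : (row i M <= row_base M)%MS by rewrite eq_row_base row_sub.
  by apply/imsetP; exists d; rewrite // -dE rowK.
apply: leq_trans (leq_imset_card _ _) _.
by rewrite card_mx mul1n card_Fp // leq_exp2l.
Qed.

(** * The kissing number *)

Lemma card_le_finset (T : Type) (A : set T) (K : finType) (Q : {set K})
    (f : T -> K) :
  (forall x, A x -> f x \in Q) -> {in A &, injective f} ->
  A #<= `I_#|Q|%classic.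
Proof.
move=> fQ f_inj; pose g x := index (f x) (enum Q).
have g_inj : {in A &, injective g}.
  move=> x y Ax Ay; rewrite /g => /(congr1 (nth (f x) (enum Q))).
  rewrite !nth_index ?mem_enum; last 2 first.
  - by apply: fQ; exact: set_mem Ay.
  - by apply: fQ; exact: set_mem Ax.
  exact: f_inj.
have g_fun : {homo g : x / A x >-> (`I_#|Q|)%classic x}.
  by move=> x Ax; rewrite /= cardE index_mem mem_enum; exact: fQ.
have [h gE] := Pinj g_inj; move: g_fun; rewrite gE => /injPfun[h' _].
exact: inj_card_le h'.
Qed.

Lemma card_unit_vectors_lt (R : realType) (n : nat) (L : set 'rV[R]_n) :
  (0 < n)%N -> is_lattice L -> l1_minimum L 1 ->
  exists2 m, (m < 12 * (2 ^ n - 1))%N & l1_unit_vectors L #<= `I_m%classic.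
Proof.
move=> n_gt0 /is_lattice_of[B Bu ->] min1.
set U := l1_unit_vectors _.
pose P := [set p | `[< exists2 x, U x & p = (coords_mod2 B x, supp x) >]]%SET.
have PP c S : (c, S) \in P ->
    exists x, [/\ U x, coords_mod2 B x = c & supp x = S].
  by rewrite finset.inE => /asboolP[x Ux [-> ->]]; exists x.
have inP x : U x -> (coords_mod2 B x, supp x) \in P.
  by move=> Ux; rewrite finset.inE; apply/asboolP; exists x.
have U_neq0 x : U x -> x != 0.
  move=> [_ x1]; apply: contra_eqN x1 => /eqP->.
  by rewrite /l1norm big1 => [|i _]; rewrite ?mxE ?normr0 // eq_sym oner_eq0.
have meet x : U x -> ~~ [disjoint supp x & supp x].
  by move=> /U_neq0; rewrite -setI_eq0 finset.setIid supp_eq0.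
have P_lt : (#|P| < 6 * (2 ^ n - 1))%N.
  apply: (@labelled_sets_count n _ P 0) => //.
  - by rewrite card_mx mul1n card_Fp.
  - by move=> c S /PP[x [Ux <- _]]; exact: coords_mod2_neq0.
  - by move=> c S /PP[x [Ux _ <-]]; rewrite supp_eq0 U_neq0.
  - move=> c S S' /PP[x [Ux xc <-]] /PP[y [Uy yc <-]] xy.
    have [e|e|//] := same_class_disjoint Bu min1 Ux Uy (etrans xc (esym yc)).
      by rewrite e eqxx in xy.
    by rewrite e suppN eqxx in xy.
  - move=> S; apply: (card_classes_supp_le Bu) => c; rewrite finset.inE.
    by move=> /PP[x [[Lx _] xc xS]]; exists x; rewrite xS.
(* The sign at one coordinate, which depends only on the support, separates [x]
   from [- x]. *)
pose positive (x : 'rV[R]_n) :=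
  if [pick i in supp x] is Some i then 0 < x 0 i else false.
pose f x := ((coords_mod2 B x, supp x), positive x).
exists #|finset.setX P [set: bool]%SET|.
  by rewrite finset.cardsX cardsT card_bool; lia.
apply: (@card_le_finset _ _ _ _ f).
  by move=> x Ux; rewrite finset.inE /= inP // finset.inE.
move=> x y /set_mem Ux /set_mem Uy [xy_class xy_supp].
have [//|xNy|] := same_class_disjoint Bu min1 Ux Uy xy_class; last first.
  by rewrite xy_supp (negPf (meet y Uy)).
rewrite /positive xy_supp; case: pickP => [i|supp0].
  rewrite finset.inE xNy mxE oppr_gt0 => yi0.
  by case: ltgtP yi0.
case/negP: (U_neq0 y Uy); rewrite -supp_eq0; apply/eqP/setP => i.
by rewrite finset.in_set0 supp0.
Qed.

Lemma integer_lattice (R : realType) (n : nat) : (0 < n)%N ->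
  exists2 L : set 'rV[R]_n, is_lattice L & l1_minimum L 1.
Proof.
move=> n_gt0; pose b := [tuple delta_mx 0 i : 'rV[R]_n | i < n].
have sumE (z : 'I_n -> int) : \sum_i tnth b i *~ z i = \row_i (z i)%:~R.
  rewrite [RHS]row_sum_delta; apply: eq_bigr => i _.
  by rewrite tnth_mktuple mxE scaler_int.
exists [set x | exists z : 'I_n -> int, x = \sum_(i < n) tnth b i *~ z i]%classic.
  exists b => //; rewrite basisEdim dimvf dim_matrix mul1r size_tuple leqnn andbT.
  apply/subvP => x _; rewrite (row_sum_delta x).
  apply: memv_suml => i _; apply/memvZ/memv_span.
  by rewrite -(tnth_mktuple (fun i => delta_mx 0 i : 'rV[R]_n) i) mem_tnth.
split.
  pose i0 := Ordinal n_gt0; exists (delta_mx 0 i0); split.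
  - exists (fun i => (i == i0)%:Z); rewrite sumE; apply/rowP => i.
    by rewrite !mxE eqxx /= eq_sym.
  - by apply/eqP => /rowP/(_ i0)/eqP; rewrite !mxE !eqxx oner_eq0.
  - rewrite /l1norm (bigD1 i0) //= mxE !eqxx normr1 big1 ?addr0 // => i ii0.
    by rewrite mxE (negPf ii0) andbF normr0.
move=> _ [z ->]; rewrite sumE => z_neq0.
have [i zi0] : exists i, z i != 0.
  apply/existsP; apply: contraNT z_neq0 => /existsPn z0.
  by apply/eqP/rowP => i; rewrite !mxE; move: (z0 i); rewrite negbK => /eqP ->.
rewrite /l1norm (bigD1 i) //= mxE; apply: (@le_trans _ _ `|(z i)%:~R|).
  by rewrite norm_intr_ge1 ?intr_eq0 // intr_int.
by rewrite lerDl sumr_ge0.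
Qed.

Theorem theorem3 (R : realType) (n : nat) (hn : (1 <= n)%N) :
  exists k : nat,
    is_cross_polytope_lattice_kissing_number R n k /\
    (k < 12 * (2 ^ n - 1))%N.
Proof.
pose attained k := exists L : set 'rV[R]_n,
  [/\ is_lattice L, l1_minimum L 1 & l1_unit_vectors L #= `I_k%classic].
have attained_lt k : attained k -> (k < 12 * (2 ^ n - 1))%N.
  case=> L [latL minL Lk]; have [m m_lt Lm] := card_unit_vectors_lt hn latL minL.
  by apply: leq_ltn_trans m_lt; rewrite -card_le_II -(card_le_eql Lk).
have card_attained (L : set 'rV[R]_n) : is_lattice L -> l1_minimum L 1 ->
    exists2 k, attained k & l1_unit_vectors L #= `I_k%classic.
  move=> latL minL; have [m _ Lm] := card_unit_vectors_lt hn latL minL.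
  have /finite_setP[k Lk] : finite_set (l1_unit_vectors L).
    by apply/finite_set_leP; exists m.
  by exists k => //; exists L.
have exK : exists k, `[< attained k >].
  have [L latL minL] := integer_lattice R hn.
  by have [k kA _] := card_attained L latL minL; exists k; apply/asboolP.
have ubK k : `[< attained k >] -> (k <= 12 * (2 ^ n - 1))%N.
  by move=> /asboolP/attained_lt/ltnW.
case: (ex_maxnP exK ubK) => k /asboolP kA k_max.
exists k; split; last exact: attained_lt.
split=> // L latL minL; have [j jA Lj] := card_attained L latL minL.
by rewrite (card_le_eql Lj) card_le_II k_max //; apply/asboolP.
Qed.
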